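(* Let $K$ be an LECS-field, and let $\mathbb{U} \subseteq K^\times$ be the group of all roots of unity in $K$. If $f \in \mathcal{E}$ is an exponential polynomial over $K$ which vanishes on an infinite subset $X$ of $\mathbb{U}$, then $f$ is the zero polynomial in $\mathcal{E}$.
   Context: An LEC-field is an algebraically closed field $K$ of characteristic $0$ equipped with a surjective group homomorphism $z \mapsto e^z$ from $(K,+)$ onto $(K^\times,\cdot)$ whose kernel is an infinite cyclic group, denoted $2\pi i\mathbb{Z}$. An LECS-field is an LEC-field satisfying Schanuel's Conjecture (SC): for all $\alpha_1,\ldots,\alpha_n \in K$, the transcendence degree over $\mathbb{Q}$ of $(\alpha_1,\ldots,\alpha_n,e^{\alpha_1},\ldots,e^{\alpha_n})$ is at least the dimension of the $\mathbb{Q}$-linear span of $\alpha_1,\ldots,\alpha_n$. $\mathcal{E}$ is the ring (under the usual addition and multiplication) of exponential polynomial functions on $K$ of the form $f(z) = \lambda_1 e^{\mu_1 z} + \cdots + \lambda_N e^{\mu_N z}$ with $\lambda_i, \mu_i \in K$. *)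

(* Defs.v *)
From HB Require Import structures.
From mathcomp Require Import all_boot all_order all_algebra.
From mathcomp Require Import mpoly.
From mathcomp Require Import boolp classical_sets cardinality.

Set Implicit Arguments.
Unset Strict Implicit.
Unset Printing Implicit Defensive.

Import GRing.Theory.
Local Open Scope ring_scope.
Local Open Scope classical_set_scope.

(* K always has characteristic 0 below, so that [ratr : rat -> K] is the
   embedding of the prime field Q. *)

Section Rationals.
Variable K : fieldType.

Definition Qeval n (v : n.-tuple K) (p : {mpoly rat[n]}) : K :=
  mmap ratr (tnth v) p.

Definition alg_independent n (v : n.-tuple K) : Prop :=
  forall p : {mpoly rat[n]}, Qeval v p = 0 -> p = 0.

(* The subfield Q(v_1, ..., v_n) of K. *)
Definition Qadjoin n (v : n.-tuple K) : set K :=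
  [set x | exists p q : {mpoly rat[n]},
     Qeval v q != 0 /\ x = Qeval v p / Qeval v q].

(* The transcendence degree of an extension L / Q is the largest size of a
   family of elements of L algebraically independent over Q; it is at least d
   when such a family of size d exists. *)
Definition trdeg_ge n (v : n.-tuple K) (d : nat) : Prop :=
  exists b : d.-tuple K, [set` b] `<=` Qadjoin v /\ alg_independent b.

Definition Qcomb n (v : n.-tuple K) (c : 'I_n -> rat) : K :=
  \sum_(i < n) ratr (c i) * tnth v i.

Definition Qspan n (v : n.-tuple K) : set K :=
  [set x | exists c : 'I_n -> rat, x = Qcomb v c].

Definition lin_independent n (v : n.-tuple K) : Prop :=
  forall c : 'I_n -> rat, Qcomb v c = 0 -> forall i, c i = 0.

Definition Qspan_dim n (v : n.-tuple K) (d : nat) : Prop :=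
  exists b : d.-tuple K, lin_independent b /\ Qspan b = Qspan v.

End Rationals.

Section ExponentialFields.
Variables (K : closedFieldType) (e : K -> K).

(* Algebraic closedness is carried by the type of K. *)
Record LEC_field : Prop := {
  LEC_char0 : [pchar K] =i pred0;
  LEC_expD : forall x y, e (x + y) = e x * e y;
  LEC_exp_neq0 : forall x, e x != 0;
  LEC_exp_surj : forall y, y != 0 -> exists x, e x = y;
  LEC_ker : exists w : K, injective (fun m : int => w *~ m) /\
              [set x | e x = 1] = range (fun m : int => w *~ m)
}.

Definition Schanuel : Prop :=
  forall (n : nat) (a : n.-tuple K) (d : nat),
    Qspan_dim a d -> trdeg_ge [tuple of a ++ map_tuple e a] d.

Definition LECS_field : Prop := LEC_field /\ Schanuel.

Definition exp_poly : set (K -> K) :=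
  [set f | exists (N : nat) (lambda mu : 'I_N -> K),
     forall z, f z = \sum_(i < N) lambda i * e (mu i * z)].

End ExponentialFields.

Definition roots_of_unity (K : fieldType) : set K :=
  [set z | exists2 n : nat, (0 < n)%N & n.-unity_root z].

(* Main.v *)
(* Choose for each x in X a minimal nonempty vanishing subsum of f(x); by the
   pigeonhole principle one index set J serves infinitely many x. If all
   exponents mu_j (j in J) agree, the J-part of f vanishes identically and is
   removed. Otherwise subtract one exponent mu_{j0} from all the others, and let
   L be the algebraic closure in K of the field generated by the lambda_i and mu_i.
   Whenever some mu_j x is not in the Q-span V of finitely many elements treated so
   far, the relation f(x) = 0 is a nontrivial algebraic relation between the new
   exponentials (nontrivial by minimality of J), so it makes the transcendence
   degree over L of the exponentials drop once more below the Q-dimension of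
   the exponents. By Schanuel this happens at most trdeg(L) times, so infinitely
   many roots of unity x lie in a finite-dimensional Q-space. This is impossible:
   the space they span lies in a cyclotomic field Q(zeta_M), and phi(n) <= M bounds
   the orders n of the roots of unity it contains. *)
Require Import Defs.
From HB Require Import structures.
From mathcomp Require Import all_boot all_order all_algebra all_field.
From mathcomp Require Import polyXY mpoly ring zify.
From mathcomp Require Import boolp classical_sets cardinality.

Set Implicit Arguments.
Unset Strict Implicit.
Unset Printing Implicit Defensive.

Import GRing.Theory Num.Theory.
Local Open Scope ring_scope.
Local Open Scope classical_set_scope.

(** * Subfields and relative algebraic closure *)

Section Subfields.
Variable K : fieldType.
Implicit Types (F G : set K) (x y : K) (p : {poly K}).

Record is_subfield F : Prop := {
  subfield1 : F 1;
  subfieldB : forall x y, F x -> F y -> F (x - y);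
  subfield_div : forall x y, F x -> F y -> F (x / y) }.

Section Closure.
Variables (F : set K) (hF : is_subfield F).

Lemma subfield0 : F 0.
Proof. by rewrite -(subrr 1); apply: (subfieldB hF); apply: (subfield1 hF). Qed.
Lemma subfieldN x : F x -> F (- x).
Proof. by move=> Fx; rewrite -sub0r; apply: (subfieldB hF) Fx; apply: subfield0. Qed.
Lemma subfieldD x y : F x -> F y -> F (x + y).
Proof. by move=> Fx Fy; rewrite -[y]opprK; apply: (subfieldB hF) => //; apply: subfieldN. Qed.
Lemma subfieldV x : F x -> F x^-1.
Proof. by move=> Fx; rewrite -div1r; apply: (subfield_div hF) Fx; apply: subfield1 hF. Qed.
Lemma subfieldM x y : F x -> F y -> F (x * y).
Proof. by move=> Fx Fy; rewrite -[y]invrK; apply: (subfield_div hF) => //; apply: subfieldV. Qed.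
Lemma subfieldX x n : F x -> F (x ^+ n).
Proof.
by move=> Fx; elim: n => [|n IH]; rewrite ?expr0 ?exprS; [apply: subfield1 hF|apply: subfieldM].
Qed.
Lemma subfield_sum (I : Type) (r : seq I) (P : pred I) (f : I -> K) :
  (forall i, P i -> F (f i)) -> F (\sum_(i <- r | P i) f i).
Proof. by move=> Ff; apply: (@big_ind K F) => //; [apply: subfield0|apply: subfieldD]. Qed.
Lemma subfield_prod (I : Type) (r : seq I) (P : pred I) (f : I -> K) :
  (forall i, P i -> F (f i)) -> F (\prod_(i <- r | P i) f i).
Proof. by move=> Ff; apply: (@big_ind K F) => //; [apply: subfield1 hF|apply: subfieldM]. Qed.
Lemma subfield_nat n : F n%:R.
Proof.
by elim: n => [|n IH]; rewrite ?mulrS; [apply: subfield0|apply: subfieldD (subfield1 hF) IH].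
Qed.
Lemma subfield_int (m : int) : F m%:~R.
Proof. by case: m => n; rewrite ?NegzE ?mulrNz; [|apply: subfieldN]; apply: subfield_nat. Qed.
Lemma subfield_ratr (r : rat) : F (ratr r).
Proof. by apply: (subfield_div hF); apply: subfield_int. Qed.
Lemma subfield_horner p x : (forall i, F p`_i) -> F x -> F p.[x].
Proof.
move=> Fp Fx; rewrite horner_coef; apply: subfield_sum => i _.
by apply: subfieldM => //; apply: subfieldX.
Qed.

Definition subfield_pred : {pred K} := fun x => `[< F x >].
Lemma subfield_predE x : (x \in subfield_pred) = `[< F x >]. Proof. by []. Qed.

Lemma subfield_divring_closed : divring_closed subfield_pred.
Proof.
split; rewrite /in_mem /=; first exact/asboolP/(subfield1 hF).
  by move=> x y /asboolP Fx /asboolP Fy; apply/asboolP/(subfieldB hF).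
by move=> x y /asboolP Fx /asboolP Fy; apply/asboolP/(subfield_div hF).
Qed.

(* The proof [h] is a parameter so that the field instances can be inferred. *)
Record subfield_type (h : is_subfield F) := SubfieldType {
  subfield_val :> K;
  subfield_valP : subfield_val \in subfield_pred }.
Local Notation sfT := (subfield_type hF).
HB.instance Definition _ := [isSub of sfT for @subfield_val hF].
HB.instance Definition _ := [Choice of sfT by <:].
HB.instance Definition _ := GRing.isDivringClosed.Build K subfield_pred subfield_divring_closed.
HB.instance Definition _ := [SubChoice_isSubUnitRing of sfT by <:].
HB.instance Definition _ := [SubNzRing_isSubComNzRing of sfT by <:].
HB.instance Definition _ := [SubComUnitRing_isSubIntegralDomain of sfT by <:].
HB.instance Definition _ := [SubIntegralDomain_isSubField of sfT by <:].

Lemma subfield_val_mem (a : sfT) : F (val a).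
Proof. by have := valP a; rewrite subfield_predE => /asboolP. Qed.

Definition to_subfield x : sfT := insubd 0 x.
Lemma to_subfieldK x : F x -> val (to_subfield x) = x.
Proof. by move=> Fx; rewrite /to_subfield insubdK // subfield_predE; apply/asboolP. Qed.

Lemma poly_over_subfield p : (forall i, F p`_i) -> exists q : {poly sfT}, p = map_poly val q.
Proof.
move=> Fp; exists (\poly_(i < size p) to_subfield p`_i); apply/polyP => i.
rewrite coef_map coef_poly; case: ltnP => [_|hi]; first exact/esym/to_subfieldK.
by rewrite raddf0 nth_default.
Qed.

Definition algcl F x := exists p, [/\ p != 0, forall i, F p`_i & root p x].

Lemma algclE x : algcl F x <-> algebraicOver (val : sfT -> K) x.
Proof.
split=> [[p [p0 /poly_over_subfield[q eq] px]]|[q q0 qx]].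
  by exists q; [apply: contra_neq p0 => q0; rewrite eq q0 map_poly0|rewrite -eq].
exists (map_poly val q); split=> //; first by rewrite map_poly_eq0.
by move=> i; rewrite coef_map; apply: subfield_val_mem.
Qed.
End Closure.
Arguments poly_over_subfield {F} hF {p}.
Arguments to_subfieldK {F} hF {x}.

Lemma sub_algcl F : is_subfield F -> F `<=` algcl F.
Proof.
move=> hF x Fx; apply/(algclE hF).
by rewrite -(to_subfieldK hF Fx); apply: algebraic_id.
Qed.

Lemma algcl_mono F G : F `<=` G -> algcl F `<=` algcl G.
Proof. by move=> FG x [p [p0 Fp px]]; exists p; split=> // i; apply: FG. Qed.

Lemma algcl_subfield F : is_subfield F -> is_subfield (algcl F).
Proof.
move=> hF; split; first by apply: sub_algcl => //; apply: subfield1.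
  by move=> x y /(algclE hF) hx /(algclE hF) hy; apply/(algclE hF)/algebraic_sub.
by move=> x y /(algclE hF) hx /(algclE hF) hy; apply/(algclE hF)/algebraic_div.
Qed.

(** Transitivity of algebraicity: the coefficients of [p] are integral over [F], hence so is every
    root of [p]. *)
Lemma algclK F : is_subfield F -> algcl (algcl F) `<=` algcl F.
Proof.
move=> hF x [p [p0 Fp px]]; apply/(algclE hF)/integral_algebraic.
apply: (integral_root p0 px) => _ /(nthP 0)[i _ <-].
exact/integral_algebraic/algclE.
Qed.

(** * Subfields generated by the image of a ring *)

Section Fractions.
Variables (A : comNzRingType) (phi : {rmorphism A -> K}).

Definition fractions : set K :=
  [set x | exists a b, phi b != 0 /\ x = phi a / phi b].

Lemma fractions_subfield : is_subfield fractions.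
Proof.
split; first by exists 1, 1; rewrite rmorph1 oner_eq0 divr1.
  move=> _ _ [a [b [b0 ->]]] [c [d [d0 ->]]].
  exists (a * d - c * b), (b * d); rewrite rmorphB !rmorphM mulf_neq0 //.
  by split=> //; field; rewrite b0 d0.
move=> _ _ [a [b [b0 ->]]] [c [d [d0 ->]]].
have [c0|c0] := eqVneq (phi c) 0.
  by exists 0, 1; rewrite c0 mul0r invr0 mulr0 rmorph0 rmorph1 oner_eq0 mul0r.
exists (a * d), (b * c); rewrite !rmorphM mulf_neq0 //.
by rewrite invf_div mulf_div.
Qed.

Lemma sub_fractions a : fractions (phi a).
Proof. by exists a, 1; rewrite rmorph1 oner_eq0 divr1. Qed.

(** Lets algebraicity over the fractions of [A] be witnessed by polynomials over [A] itself; when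
    [A] is a polynomial ring these are polynomials in one more variable. *)
Lemma clear_denominators p : (forall i, fractions p`_i) ->
  exists (P : {poly A}) (c : A), phi c != 0 /\ map_poly phi P = phi c *: p.
Proof.
elim/poly_ind: p => [|p a IH] hp.
  by exists 0, 1; rewrite rmorph1 oner_eq0 rmorph0 scaler0.
have [i|P [c [c0 eP]]] := IH.
  by have := hp i.+1; rewrite coefD coefMX coefC addr0.
have [u [v [v0 ea]]] : fractions a by have := hp 0; rewrite coefD coefMX coefC add0r.
exists (v *: P * 'X + (u * c)%:P), (c * v); rewrite rmorphM mulf_neq0 //; split=> //.
rewrite rmorphD rmorphM /= map_polyX map_polyC map_polyZ eP /= scalerDr; congr (_ + _).
  by rewrite scalerA -scalerAl [phi v * _]mulrC.
rewrite -mul_polyC -polyCM ea rmorphM.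
by congr (_%:P); field.
Qed.

Lemma algcl_fractionsP x :
  algcl fractions x <->
  exists2 P : {poly A}, map_poly phi P != 0 & root (map_poly phi P) x.
Proof.
split=> [[p [p0 /clear_denominators[P [c [c0 eP]]] px]]|[P P0 Px]].
  by exists P; rewrite eP ?scaler_eq0 ?negb_or ?c0 // rootE hornerZ (eqP px) mulr0.
by exists (map_poly phi P); split=> // i; rewrite coef_map; apply: sub_fractions.
Qed.

End Fractions.

(** * Simple extensions and the exchange property *)

Section Adjunction.
Variables (F : set K) (hF : is_subfield F) (x : K).

Definition eval_at : {poly subfield_type hF} -> K := fun a => (map_poly val a).[x].

Lemma eval_at_zmod : zmod_morphism eval_at.
Proof. by move=> a b; rewrite /eval_at rmorphB hornerD hornerN. Qed.
Lemma eval_at_monoid : monoid_morphism eval_at.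
Proof. by split=> [|a b]; rewrite /eval_at ?rmorph1 ?hornerC ?rmorphM ?hornerM. Qed.
HB.instance Definition _ := GRing.isZmodMorphism.Build _ _ eval_at eval_at_zmod.
HB.instance Definition _ := GRing.isMonoidMorphism.Build _ _ eval_at eval_at_monoid.

Definition adj : set K := fractions eval_at.

Lemma adj_subfield : is_subfield adj. Proof. exact: fractions_subfield. Qed.

Lemma sub_adj : F `<=` adj.
Proof.
move=> y Fy; have <- : eval_at (to_subfield hF y)%:P = y; last exact: sub_fractions.
by rewrite /eval_at map_polyC hornerC; apply: to_subfieldK.
Qed.

Lemma adj_gen : adj x.
Proof.
have <- : eval_at 'X = x; last exact: sub_fractions.
by rewrite /eval_at map_polyX hornerX.
Qed.

Lemma adj_min G : is_subfield G -> F `<=` G -> G x -> adj `<=` G.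
Proof.
move=> hG FG Gx _ [a [b [_ ->]]]; apply: (subfield_div hG); apply: subfield_horner => // i;
  rewrite coef_map; apply: FG; exact: subfield_val_mem.
Qed.
End Adjunction.

(* Relatively algebraically closed subfields of [K]. *)
Record is_acf F : Prop := {
  acf_subfield :> is_subfield F;
  acf_closed : algcl F `<=` F }.

(** After clearing denominators, [y] is a root of P(x, Y) with P over [F]. Read in the other
    variable, P gives an equation for [x] over F(y). It is nontrivial: its coefficients are
    polynomials over [F] evaluated at [y], which is not algebraic over [F]. *)
Lemma algcl_exchange F (hF : is_acf F) x y :
  algcl (adj hF x) y -> ~ F y -> algcl (adj hF y) x.
Proof.
move=> /algcl_fractionsP[P P0 Py] nFy.
pose f : {rmorphism subfield_type hF -> K} := val.
apply/algcl_fractionsP; exists (swapXY P); last first.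
  rewrite rootE (map_poly_comp (horner_eval y) (map_poly f)) -swapXY_map.
  have hx : x = horner_eval y x%:P by rewrite /horner_eval hornerC.
  rewrite [X in _.[X]]hx (horner_map (horner_eval y)) horner_swapXY.
  by rewrite -map_poly_comp -rootE.
apply: contra_neq P0 => Q0.
suff -> : P = 0 by rewrite rmorph0.
rewrite -[P]swapXYK; apply/eqP; rewrite swapXY_eq0; apply/eqP/polyP => i.
rewrite coef0; apply/eqP; apply: contra_notT nFy => Qi.
apply: (acf_closed hF); apply/(algclE hF); exists (swapXY P)`_i => //.
by move/polyP/(_ i): Q0; rewrite coef_map coef0 => /eqP.
Qed.

Definition acl_adj F (hF : is_acf F) x := algcl (adj hF x).

Lemma acl_adj_acf F (hF : is_acf F) x : is_acf (acl_adj hF x).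
Proof.
by split; [apply: algcl_subfield; apply: adj_subfield|apply: algclK; apply: adj_subfield].
Qed.
End Subfields.

(** * Exchange and the Steinitz bound *)

Section Pregeometry.
Variables (T : eqType) (good : set T -> Prop).
Implicit Types (F G : set T) (s t : seq T) (x y : T).

(** The smallest good set containing [F] and [t]. Two notions of good set are used below,
    Q-subspaces and relatively algebraically closed subfields, so that linear dimension and
    transcendence degree share one theory. *)
Definition hull F t : set T :=
  [set y | forall G, good G -> F `<=` G -> (forall x, x \in t -> G x) -> G y].

Lemma hull_min F t G :
  good G -> F `<=` G -> (forall x, x \in t -> G x) -> hull F t `<=` G.
Proof. by move=> gG FG tG y; apply. Qed.

Lemma sub_hull F t : F `<=` hull F t.
Proof. by move=> y Fy G _ FG _; apply: FG. Qed.

Lemma mem_hull F t x : x \in t -> hull F t x.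
Proof. by move=> xt G _ _; apply. Qed.

Fixpoint indep F s : Prop :=
  if s is x :: s' then ~ F x /\ indep (hull F [:: x]) s' else True.

Hypothesis good_hull : forall F t, good (hull F t).

Lemma hullS F t F' t' : F `<=` hull F' t' -> (forall x, x \in t -> hull F' t' x) ->
  hull F t `<=` hull F' t'.
Proof. by move=> *; apply: hull_min. Qed.

Lemma hull_cat F s t : hull (hull F s) t = hull F (s ++ t).
Proof.
apply/seteqP; split.
  apply: hullS => [|x xt]; last by apply: mem_hull; rewrite mem_cat xt orbT.
  apply: hullS => [|x xs]; first exact: sub_hull.
  by apply: mem_hull; rewrite mem_cat xs.
apply: hullS => [|x]; first by apply: subset_trans; apply: sub_hull.
rewrite mem_cat => /orP[xs|]; last exact: mem_hull.
by apply: sub_hull; apply: mem_hull.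
Qed.

Lemma hull_nil F : good F -> hull F [::] = F.
Proof.
by move=> gF; apply/seteqP; split; [apply: hull_min|apply: sub_hull].
Qed.

Lemma indep_rcons F s x : good F ->
  indep F (rcons s x) <-> indep F s /\ ~ hull F s x.
Proof.
elim: s F => [|y s IH] F gF /=; first by rewrite hull_nil //; split=> -[].
rewrite IH; last exact: good_hull.
by rewrite hull_cat /=; tauto.
Qed.

Lemma indep_cat F s t : good F -> indep F s -> indep (hull F s) t -> indep F (s ++ t).
Proof.
move=> gF ind_s; elim/last_ind: t => [|t x IH]; first by rewrite cats0.
rewrite -rcons_cat indep_rcons // indep_rcons // hull_cat => -[/IH ind_st nx].
by split.
Qed.

Hypothesis exchange_hull : forall F x y,
  good F -> hull F [:: x] y -> ~ F y -> hull F [:: y] x.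

(** When the elements of [t] are added one by one, [u] is the one at which [x] enters the hull; it
    is the element that [x] can replace. *)
Lemma hull_split F t x : good F -> hull F t x -> ~ F x ->
  exists t1 u t2, [/\ t = t1 ++ u :: t2, ~ hull F t1 x & hull F (rcons t1 u) x].
Proof.
move=> gF + nFx; elim/last_ind: t => [|t u IH]; first by rewrite hull_nil.
have [tx _|ntx utx] := pselect (hull F t x).
  have [t1 [v [t2 [-> *]]]] := IH tx.
  by exists t1, v, (rcons t2 u); rewrite rcons_cat.
by exists t, u, [::]; rewrite cats1.
Qed.

(** The first element [x] of [s] replaces some [u] in [t]. The rest of [s] is independent over the
    hull of [F] and [x] and lies in the hull of [t] without [u] over this larger base, so induction
    applies. *)
Theorem steinitz F s t : good F -> indep F s -> (forall x, x \in s -> hull F t x) ->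
  (size s <= size t)%N.
Proof.
elim: s F t => // x s IH F t gF [nFx ind_s] st.
have tx : hull F t x by apply: st; rewrite inE eqxx.
have [t1 [u [t2 [et nt1 tu]]]] := hull_split gF tx nFx.
have xu : hull F (x :: t1) u.
  have : hull (hull F t1) [:: x] u.
    by apply: exchange_hull => //; rewrite hull_cat cats1.
  rewrite hull_cat cats1; apply: hull_min => // [|z]; first exact: sub_hull.
  by rewrite mem_rcons; apply: mem_hull.
have : (size s <= size (t1 ++ t2))%N.
  apply: (IH (hull F [:: x])) => // y ys; rewrite hull_cat.
  have : hull F t y by apply: st; rewrite inE ys orbT.
  apply: hullS => [|z]; first exact: sub_hull.
  rewrite et mem_cat inE => /or3P[zt|/eqP->|zt].
  - by apply: mem_hull; rewrite inE mem_cat zt !orbT.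
  - apply: hullS xu => [|w]; first exact: sub_hull.
    rewrite inE => wt; apply: mem_hull; rewrite inE mem_cat.
    by case/orP: wt => ->; rewrite ?orbT.
  - by apply: mem_hull; rewrite inE mem_cat zt !orbT.
by rewrite et !size_cat /= addnS.
Qed.

(** An independent list in [X] whose hull misses a point of [X] can be extended by that point;
    [steinitz] bounds its length by that of [c], so this stops. *)
Lemma maximal_indep F c (X : set T) : good F -> X `<=` hull F c ->
  exists s, [/\ indep F s, (forall x, x \in s -> X x) & X `<=` hull F s].
Proof.
move=> gF Xc.
suff max_from k : forall s, (size c <= size s + k)%N -> indep F s ->
    (forall x, x \in s -> X x) ->
    exists s', [/\ indep F s', (forall x, x \in s' -> X x) & X `<=` hull F s'].
  by apply: (max_from (size c) [::]).
elim: k => [|k IH] s sz ind_s sX;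
  (have [Xs|/existsNP[x /not_implyP[Xx nsx]]] := pselect (X `<=` hull F s);
    [by exists s | have ind_sx : indep F (rcons s x) by apply/(indep_rcons _ _ gF)]);
  have sxX y : y \in rcons s x -> X y
    by rewrite mem_rcons inE => /orP[/eqP->|/sX].
  have := steinitz gF ind_sx (fun y h => Xc y (sxX y h)).
  by rewrite size_rcons => /(leq_trans) /(_ sz); rewrite addn0 ltnn.
by apply: (IH (rcons s x)) => //; rewrite size_rcons addSnnS.
Qed.
End Pregeometry.

(** * Relatively algebraically closed subfields and Q-subspaces as closure systems *)

Section Algebraic.
Variable K : fieldType.
Implicit Types (F G : set K) (x y : K).

Lemma acf_hull F t : is_acf (hull (@is_acf K) F t).
Proof.
split; first split.
- by move=> G gG _ _; apply: subfield1 gG.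
- by move=> x y Hx Hy G gG FG tG; apply: (subfieldB gG); [apply: Hx|apply: Hy].
- by move=> x y Hx Hy G gG FG tG; apply: (subfield_div gG); [apply: Hx|apply: Hy].
- move=> x Hx G gG FG tG; apply: (acf_closed gG); apply: algcl_mono Hx.
  by move=> y; apply.
Qed.

Lemma acf_exchange F x y : is_acf F ->
  hull (@is_acf K) F [:: x] y -> ~ F y -> hull (@is_acf K) F [:: y] x.
Proof.
move=> hF xy nFy.
have : acl_adj hF y x.
  apply: algcl_exchange nFy; apply: (hull_min (acl_adj_acf hF x)) xy.
    by apply: subset_trans (sub_adj hF x) (sub_algcl (adj_subfield hF x)).
  move=> _ /[!inE] /eqP->; exact: (sub_algcl (adj_subfield hF x)) (adj_gen hF x).
have hG := acf_hull F [:: y].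
move=> /(algcl_mono _) Hx; apply: (acf_closed hG); apply: Hx.
apply: adj_min; [exact: acf_subfield|exact: sub_hull|].
by apply: mem_hull; rewrite inE.
Qed.

Record is_Qspace F : Prop := {
  Qspace0 : F 0;
  QspaceB : forall x y, F x -> F y -> F (x - y);
  QspaceZ : forall (r : rat) x, F x -> F (ratr r * x) }.

Lemma Qspace_hull F t : is_Qspace (hull is_Qspace F t).
Proof.
split; first by move=> G gG _ _; apply: Qspace0 gG.
- by move=> x y Hx Hy G gG FG tG; apply: (QspaceB gG); [apply: Hx|apply: Hy].
- by move=> r x Hx G gG FG tG; apply: (QspaceZ gG); apply: Hx.
Qed.

Section QspaceClosure.
Variables (F : set K) (hF : is_Qspace F).
Lemma QspaceN x : F x -> F (- x).
Proof. by move=> Fx; rewrite -sub0r; apply: (QspaceB hF) Fx; apply: Qspace0. Qed.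
Lemma QspaceD x y : F x -> F y -> F (x + y).
Proof. by move=> Fx Fy; rewrite -[y]opprK; apply: (QspaceB hF) => //; apply: QspaceN. Qed.
Lemma Qspace_sum (I : Type) (r : seq I) (P : pred I) (f : I -> K) :
  (forall i, P i -> F (f i)) -> F (\sum_(i <- r | P i) f i).
Proof. by move=> Ff; apply: (@big_ind K F) => //; [apply: Qspace0|apply: QspaceD]. Qed.
End QspaceClosure.
End Algebraic.

(** * The embedding of Q in characteristic 0 and exchange for Q-subspaces *)

Section RatrChar0.
Variables (K : fieldType) (char0 : [pchar K] =i pred0).

Lemma char0_int_eq0 (m : int) : (m%:~R == 0 :> K) = (m == 0).
Proof.
have nat_eq0 n : (n%:R == 0 :> K) = (n == 0)%N by move/pcharf0P: char0.
by case: m => n; rewrite ?NegzE ?mulrNz ?oppr_eq0 -pmulrn nat_eq0.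
Qed.

Lemma ratr_fracE (a b : int) : b != 0 -> ratr (a%:~R / b%:~R) = a%:~R / b%:~R :> K.
Proof.
move=> b0; rewrite /ratr; set x : rat := _ / _.
have d0 : (denq x)%:~R != 0 :> K by rewrite char0_int_eq0 denq_neq0.
have b0K : b%:~R != 0 :> K by rewrite char0_int_eq0.
have e : numq x * b = a * denq x.
  apply: (@intr_inj rat); rewrite !rmorphM /= -[in RHS]mulrC.
  have -> : (numq x)%:~R = x * (denq x)%:~R by rewrite numqE.
  by rewrite /x mulrAC divfK ?intr_eq0 // mulrC.
by apply/eqP; rewrite eqr_div // -!rmorphM /= e.
Qed.

Lemma ratr_zmod : zmod_morphism (@ratr K).
Proof.
move=> x y.
have dx : (denq x)%:~R != 0 :> K by rewrite char0_int_eq0 denq_neq0.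
have dy : (denq y)%:~R != 0 :> K by rewrite char0_int_eq0 denq_neq0.
have -> : x - y = (numq x * denq y - numq y * denq x)%:~R / (denq x * denq y)%:~R.
  rewrite rmorphB !rmorphM /= -{1}[x]divq_num_den -{1}[y]divq_num_den.
  by field; rewrite !intr_eq0 !denq_neq0.
rewrite ratr_fracE ?mulf_neq0 ?denq_neq0 // rmorphB !rmorphM /= /ratr.
by field; rewrite dx dy.
Qed.

Lemma ratr_monoid : monoid_morphism (@ratr K).
Proof.
split=> [|x y]; first by rewrite /ratr divr1.
have dx : (denq x)%:~R != 0 :> K by rewrite char0_int_eq0 denq_neq0.
have dy : (denq y)%:~R != 0 :> K by rewrite char0_int_eq0 denq_neq0.
have -> : x * y = (numq x * numq y)%:~R / (denq x * denq y)%:~R.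
  rewrite !rmorphM /= -{1}[x]divq_num_den -{1}[y]divq_num_den.
  by field; rewrite !intr_eq0 !denq_neq0.
rewrite ratr_fracE ?mulf_neq0 ?denq_neq0 // !rmorphM /= /ratr.
by field; rewrite dx dy.
Qed.

Definition ratrm : {rmorphism rat -> K} := HB.pack (@ratr K)
  (GRing.isZmodMorphism.Build _ _ _ ratr_zmod)
  (GRing.isMonoidMorphism.Build _ _ _ ratr_monoid).

Lemma ratrD x y : ratr (x + y) = ratr x + ratr y :> K. Proof. exact: (rmorphD ratrm). Qed.
Lemma ratrM x y : ratr (x * y) = ratr x * ratr y :> K. Proof. exact: (rmorphM ratrm). Qed.

Lemma Qspace_hull1 (F : set K) x y : is_Qspace F ->
  hull (@is_Qspace K) F [:: x] y -> exists r : rat, F (y - ratr r * x).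
Proof.
move=> hF xy; apply: (xy [set z | exists r : rat, F (z - ratr r * x)]).
- split; first by exists 0; rewrite (rmorph0 ratrm) mul0r subr0; apply: Qspace0.
  + move=> u v [a Fa] [b Fb]; exists (a - b); rewrite (rmorphB ratrm).
    rewrite (_ : _ - _ = (u - ratr a * x) - (v - ratr b * x)); last by rewrite /=; ring.
    exact: (QspaceB hF).
  + move=> a u [b Fb]; exists (a * b); rewrite ratrM -mulrA -mulrBr; exact: (QspaceZ hF).
- by move=> z Fz; exists 0; rewrite (rmorph0 ratrm) mul0r subr0.
- move=> z /[!inE] /eqP ->; exists 1; rewrite (rmorph1 ratrm) mul1r subrr.
  exact: Qspace0.
Qed.

Lemma Qspace_exchange (F : set K) x y : is_Qspace F ->
  hull (@is_Qspace K) F [:: x] y -> ~ F y -> hull (@is_Qspace K) F [:: y] x.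
Proof.
move=> hF /(Qspace_hull1 hF)[r Fr] nFy.
have r0 : r != 0.
  by apply: contra_not_neq nFy => r0; move: Fr; rewrite r0 (rmorph0 ratrm) mul0r subr0.
have hG := Qspace_hull F [:: y].
have -> : x = ratr r^-1 * (y - (y - ratr r * x)).
  by rewrite opprB addrC subrK mulrA -ratrM mulVf // (rmorph1 ratrm) mul1r.
apply: (QspaceZ hG); apply: (QspaceB hG); last exact: sub_hull.
by apply: mem_hull; rewrite inE.
Qed.
End RatrChar0.

(** * Linear and algebraic independence over the rationals *)

Section Independence.
Variables (K : fieldType) (char0 : [pchar K] =i pred0).

Lemma is_Qspace_set0 : is_Qspace [set 0 : K].
Proof.
by split=> [|x y -> ->|r x ->] //=; rewrite ?subrr ?mulr0.
Qed.

Lemma indep_sum0 (s : seq K) (r : nat -> rat) :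
  indep (@is_Qspace K) [set 0] s -> \sum_(i < size s) ratr (r i) * s`_i = 0 ->
  forall i, (i < size s)%N -> r i = 0.
Proof.
elim/last_ind: s => // s x IH.
rewrite (indep_rcons (@Qspace_hull K) _ _ is_Qspace_set0) => -[ind_s nx].
rewrite size_rcons big_ord_recr /= nth_rcons ltnn eqxx.
rewrite (eq_bigr (fun i : 'I_(size s) => ratr (r i) * s`_i)); last first.
  by move=> i _; rewrite nth_rcons ltn_ord.
have hG := Qspace_hull [set 0] s.
have hsum : hull (@is_Qspace K) [set 0] s (\sum_(i < size s) ratr (r i) * s`_i).
  by apply: Qspace_sum => // i _; apply: (QspaceZ hG); apply: mem_hull; apply: mem_nth.
move=> e0; have rs0 : r (size s) = 0.
  apply: contra_not_eq nx => r0.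
  have -> : x = ratr (r (size s))^-1 * (- \sum_(i < size s) ratr (r i) * s`_i).
    move/eqP: e0; rewrite addrC addr_eq0 => /eqP <-.
    rewrite mulrA -(ratrM char0) mulVf //.
    by rewrite (rmorph1 (ratrm char0)) mul1r.
  by apply: (QspaceZ hG); apply: (QspaceN hG hsum).
move: e0; rewrite rs0 (rmorph0 (ratrm char0)) mul0r addr0 => /(IH ind_s) {}IH i.
by rewrite ltnS leq_eqVlt => /orP[/eqP->|/IH].
Qed.

Lemma indep_lin_independent (s : seq K) :
  indep (@is_Qspace K) [set 0] s -> lin_independent (in_tuple s).
Proof.
move=> ind_s c; rewrite /Qcomb => e0 i.
pose r j := if insub j is Some k then c k else 0.
have rE (j : 'I_(size s)) : r j = c j by rewrite /r valK.
rewrite -rE; apply: (indep_sum0 ind_s) => //; rewrite -[RHS]e0.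
by apply: eq_bigr => j _; rewrite rE (tnth_nth 0).
Qed.

(** * Algebraic independence and transcendence degree over Q *)

Definition Qevalm n (v : n.-tuple K) : {rmorphism {mpoly rat[n]} -> K} :=
  HB.pack (Qeval v)
  (GRing.isZmodMorphism.Build _ _ _ (@mmap_is_additive n rat K (tnth v) (ratrm char0)))
  (GRing.isMultiplicative.Build _ _ _ (@mmap_is_multiplicative n rat K (tnth v) (ratrm char0))).

Lemma Qeval0 n (v : n.-tuple K) : Qeval v 0 = 0.
Proof. exact: (rmorph0 (Qevalm v)). Qed.
Lemma QevalD n (v : n.-tuple K) p q : Qeval v (p + q) = Qeval v p + Qeval v q.
Proof. exact: (rmorphD (Qevalm v)). Qed.
Lemma QevalZ n (v : n.-tuple K) c p : Qeval v (c *: p) = ratr c * Qeval v p.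
Proof. exact: (mmapZ _ (ratrm char0)). Qed.
Lemma QevalX n (v : n.-tuple K) m : Qeval v 'X_[m] = \prod_(i < n) tnth v i ^+ m i.
Proof. by rewrite /Qeval (mmapX _ (ratrm char0)). Qed.

Lemma Qeval_mwiden n (w : n.-tuple K) (v : n.+1.-tuple K) (p : {mpoly rat[n]}) :
  (forall i : 'I_n, tnth v (widen_ord (leqnSn n) i) = tnth w i) ->
  Qeval v (mwiden p) = Qeval w p.
Proof.
move=> vw; elim/mpolyind: p => [|c m p _ _ IH].
  by rewrite mwiden0 !Qeval0.
rewrite mwidenD !QevalD IH; congr (_ + _).
rewrite mwidenZ mwidenX !QevalZ; congr (_ * _).
rewrite !QevalX big_ord_recr /= mnmwiden_ordmax expr0 mulr1.
by apply: eq_bigr => i _; rewrite mnmwiden_widen vw.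
Qed.

Lemma muni_mwiden n (p : {mpoly rat[n]}) : muni (mwiden p) = p%:P.
Proof.
elim/mpolyind: p => [|c m p _ _ IH]; first by rewrite mwiden0 muni0 polyC0.
rewrite mwidenD muniD IH polyCD; congr (_ + _).
rewrite mwidenZ mwidenX muniZ -mul_mpolyC polyCM mul_polyC; congr (_ *: _).
rewrite muniE msuppX big_seq1 mcoeffX eqxx scale1r mnmwiden_ordmax expr0.
rewrite alg_polyC; congr (_%:P); congr 'X_[_]; apply/mnmP => i.
by rewrite mnmE mnmwiden_widen.
Qed.

(** Makes [mmulti] injective: a nonzero polynomial in the last variable over the others stays
    nonzero as a polynomial in all variables. *)
Lemma mmultiK n : cancel (@mmulti n rat) (@muni n rat).
Proof.
move=> p; rewrite /mmulti raddf_sum /= -[RHS]coefK poly_def; apply: eq_bigr => i _.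
rewrite muniM muni_mwiden mul_polyC rmorphXn /=; congr (_ *: _ ^+ _).
rewrite muniE msuppX big_seq1 mcoeffX eqxx scale1r mnm1E eqxx expr1.
rewrite [X in 'X_[X]](_ : _ = 0%MM) ?mpolyX0 ?scale1r //.
by apply/mnmP => j; rewrite mnmE mnm1E mnm0E -val_eqE /= gtn_eqF.
Qed.

Lemma Qeval_mmulti n (w : n.-tuple K) (v : n.+1.-tuple K) (P : {poly {mpoly rat[n]}}) :
  (forall i : 'I_n, tnth v (widen_ord (leqnSn n) i) = tnth w i) ->
  Qeval v (mmulti P) = (map_poly (Qevalm w) P).[tnth v ord_max].
Proof.
move=> vw; rewrite -[LHS]/(Qevalm v _) /mmulti rmorph_sum /map_poly horner_poly.
apply: eq_bigr => i _; rewrite rmorphM rmorphXn /=.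
rewrite (Qeval_mwiden _ vw); congr (_ * _ ^+ _).
by rewrite /Qeval (mmapX _ (ratrm char0)) mmap1U.
Qed.

(** If [v n] were algebraic over the field generated by the earlier values, clearing denominators
    would give a nonzero polynomial relation in n + 1 variables. The base [hull set0 [::]] is the
    algebraic closure of Q in [K]. *)
Lemma alg_independent_indep (v : nat -> K) n :
  alg_independent [tuple v i | i < n] ->
  indep (@is_acf K) (hull (@is_acf K) set0 [::]) (mkseq v n).
Proof.
elim: n => // n IH; set w := [tuple v i | i < n.+1] => ind_w.
have wE (i : 'I_n) : tnth w (widen_ord (leqnSn n) i) = tnth [tuple v i | i < n] i.
  by rewrite !tnth_mktuple.
rewrite mkseqS indep_rcons; [|exact: acf_hull..]; split.
  apply: IH => p p0; apply: (@inj_mwiden n rat); rewrite mwiden0.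
  by apply: ind_w; rewrite (Qeval_mwiden _ wE).
have subQ := fractions_subfield (Qevalm [tuple v i | i < n]).
have acfQ : is_acf (algcl (fractions (Qevalm [tuple v i | i < n]))).
  by split; [apply: algcl_subfield|apply: algclK].
move=> hvn.
have /algcl_fractionsP[P P0] : algcl (fractions (Qevalm [tuple v i | i < n])) (v n).
  apply: hull_min hvn => //.
    by apply: hull_min.
  move=> x /(nthP 0)[i]; rewrite size_mkseq => ltin <-; rewrite nth_mkseq //.
  apply: sub_algcl => //.
  have -> : v i = Qevalm [tuple v i | i < n] 'X_(Ordinal ltin).
    by rewrite /= /Qeval (mmapX _ (ratrm char0)) mmap1U tnth_mktuple.
  exact: sub_fractions.
have -> : v n = tnth w ord_max by rewrite tnth_mktuple.
rewrite rootE -(Qeval_mmulti _ wE) => /eqP /ind_w /(congr1 (@muni n rat)).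
by rewrite mmultiK muni0 => P00; rewrite P00 rmorph0 eqxx in P0.
Qed.

Lemma Qadjoin_subset n (v : n.-tuple K) (F : set K) :
  is_subfield F -> (forall i, F (tnth v i)) -> Qadjoin v `<=` F.
Proof.
move=> hF Fv; have FQ p : F (Qeval v p).
  apply: subfield_sum => // m _; apply: subfieldM => //; first exact: subfield_ratr.
  by apply: subfield_prod => // i _; apply: subfieldX.
by move=> _ [p [q [_ ->]]]; apply: (subfield_div hF).
Qed.

(** Makes the lower bound in Schanuel's conjecture usable for counting: [d] independent elements of
    Q(v) lie in the closure of [t], and the Steinitz bound applies. *)
Lemma trdeg_ge_size n (v : n.-tuple K) d (t : seq K) :
  trdeg_ge v d -> (forall i, hull (@is_acf K) set0 t (tnth v i)) -> (d <= size t)%N.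
Proof.
move=> [b [bQ ind_b]] vt.
have eb : mkseq (nth 0 b) d = b by rewrite -{2}(size_tuple b) mkseq_nth.
rewrite -(size_tuple b) -[X in size X]eb.
apply: (steinitz (@acf_hull K) (@acf_exchange K) (F := hull (@is_acf K) set0 [::])).
- exact: acf_hull.
- apply: alg_independent_indep.
  suff -> : [tuple b`_i | i < d] = b by [].
  by apply: eq_from_tnth => i; rewrite tnth_mktuple (tnth_nth 0).
- move=> x; rewrite eb hull_cat; last exact: acf_hull.
  move=> xb; apply: (Qadjoin_subset _ vt); first exact/acf_subfield/acf_hull.
  exact: bQ.
Qed.
End Independence.

(** * Roots of unity in finite-dimensional Q-spaces *)

(** Irreducibility of the cyclotomic polynomial over Q, drawn from its being the minimal polynomial
    of a primitive root [z] in [algC]. It is the product of the gcd and a cofactor, and [z] is a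
    root of one of them. *)
Lemma dvdp_Cyclotomic_of_not_coprimep n (q : {poly rat})
    (Phi := map_poly intr 'Phi_n : {poly rat}) :
  (0 < n)%N -> ~~ coprimep q Phi -> Phi %| q.
Proof.
move=> n_gt0 ncop; have [z prim_z] := C_prim_root_exists n_gt0.
have [P [eP mP] Pdvd] := minCpolyP z.
have ePhi : P = Phi.
  apply: (map_poly_inj (ratr : {rmorphism rat -> algC})).
  rewrite -eP (minCpoly_cyclotomic prim_z) -(Cintr_Cyclotomic prim_z).
  by rewrite -map_poly_comp; apply: eq_map_poly => m /=; rewrite ratr_int.
have [g_root|ng_root] := boolP (root (map_poly ratr (gcdp q Phi) : {poly algC}) z).
  by rewrite -ePhi; move: g_root; rewrite Pdvd => /dvdp_trans; apply; apply: dvdp_gcdl.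
have P_root : root (map_poly ratr P : {poly algC}) z by rewrite Pdvd dvdpp.
have /dvdpP[h eh] := dvdp_gcdr q Phi.
have P0 : P != 0 := monic_neq0 mP.
have Ph : P %| h.
  by move: P_root; rewrite -Pdvd ePhi eh rmorphM rootM (negPf ng_root) orbF.
have h0 : h != 0 by apply: contra_neq P0 => h0; rewrite ePhi eh h0 mul0r.
have g0 : gcdp q Phi != 0 by apply: contra_neq P0 => g0; rewrite ePhi eh g0 mulr0.
move: ncop; rewrite coprimep_def => /negP[]; rewrite eqn_leq size_poly_gt0 g0 andbT.
have := dvdp_leq h0 Ph; rewrite ePhi {1}eh size_mul //.
by rewrite -subn1 leq_subLR addnC leq_add2r.
Qed.

Section RootsOfUnity.
Variables (K : closedFieldType) (char0 : [pchar K] =i pred0).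

Lemma root_Phi n (w : K) : n.-primitive_root w ->
  root (map_poly intr 'Phi_n) w.
Proof.
move=> prim_w; have n_gt0 := prim_order_gt0 prim_w.
have : root (map_poly intr ('X^n - 1 : {poly int})) w.
  by rewrite rmorphB rmorphXn /= map_polyX rmorph1 rootE !hornerE prim_expr_order ?subrr.
rewrite -prod_Cyclotomic // rmorph_prod rootE horner_prod prodf_seq_eq0 => /hasP[d].
rewrite -dvdn_divisors // => dvd_dn /= Phi_d.
suff -> : n = d by [].
apply/eqP; rewrite eqn_dvd dvd_dn andbT (prim_order_dvd prim_w).
have d_gt0 := dvdn_gt0 n_gt0 dvd_dn.
have : root (map_poly intr ('X^d - 1 : {poly int})) w.
  rewrite -prod_Cyclotomic // rmorph_prod rootE horner_prod prodf_seq_eq0; apply/hasP.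
  by exists d => //; rewrite -dvdn_divisors.
by rewrite rmorphB rmorphXn /= map_polyX rmorph1 rootE !hornerE subr_eq0.
Qed.

(** The common root [w] keeps [q] and the n-th cyclotomic polynomial from being coprime, so the
    latter, of degree [totient n], divides [q]. *)
Lemma totient_lt_size n (w : K) (q : {poly rat}) :
  n.-primitive_root w -> q != 0 -> root (map_poly ratr q) w -> (totient n < size q)%N.
Proof.
move=> prim_w q0 qw; have n_gt0 := prim_order_gt0 prim_w.
have Phi_w : root (map_poly ratr (map_poly intr 'Phi_n)) w.
  rewrite -(eq_map_poly (f := ratrm char0)) // -map_poly_comp.
  rewrite (eq_map_poly (g := intr)) ?root_Phi // => m /=.
  by rewrite (rmorph_int (ratrm char0)).
have := @dvdp_Cyclotomic_of_not_coprimep n q n_gt0.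
have [cop _|_ /(_ isT)] := boolP (coprimep _ _).
  move: cop; rewrite -(coprimep_map (ratrm char0)) => /coprimep_root /(_ qw).
  by move=> /negP[]; exact: Phi_w.
move/(dvdp_leq q0); rewrite size_map_poly_id0 ?size_Cyclotomic //.
by rewrite (monicP (Cyclotomic_monic n)) oner_eq0.
Qed.

(** A dependence of w^k on lower powers would give a monic rational polynomial of degree k <
    [totient n] vanishing at [w]. *)
Lemma indep_powers n (w : K) : n.-primitive_root w ->
  indep (@is_Qspace K) [set 0] (mkseq (fun i => w ^+ i) (totient n)).
Proof.
move=> prim_w; suff indep_k k : (k <= totient n)%N ->
    indep (@is_Qspace K) [set 0] (mkseq (fun i => w ^+ i) k) by exact: indep_k.
elim: k => // k IH ltk.
rewrite mkseqS (indep_rcons (@Qspace_hull K) _ _ (is_Qspace_set0 _)).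
split; first exact/IH/ltnW.
pose V : set K := [set x | exists2 p : {poly rat}, (size p <= k)%N & x = (map_poly ratr p).[w]].
have hornerE' p : (map_poly ratr p).[w] = (map_poly (ratrm char0) p).[w] by [].
move=> /(_ V) [].
- split.
  + by exists 0; rewrite ?size_poly0 // map_poly0 horner0.
  + move=> _ _ [p hp ->] [q hq ->]; exists (p - q).
      by rewrite (leq_trans (size_polyD _ _)) // size_polyN geq_max hp.
    by rewrite !hornerE' rmorphB !hornerE.
  + move=> r _ [p hp ->]; exists (r *: p); first exact: leq_trans (size_scale_leq _ _) hp.
    by rewrite !hornerE' map_polyZ hornerZ.
- by move=> ? ->; exists 0; rewrite ?size_poly0 // map_poly0 horner0.
- move=> x /(nthP 0)[i]; rewrite size_mkseq => ltik <-; rewrite nth_mkseq //.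
  exists 'X^i; first by rewrite size_polyXn.
  by rewrite hornerE' map_polyXn hornerXn.
move=> p hp ewk.
have sz : size ('X^k - p) = k.+1 by rewrite size_polyDl ?size_polyXn // size_polyN.
have := @totient_lt_size n w ('X^k - p) prim_w.
rewrite -size_poly_eq0 sz ltnNge ltk => /(_ isT) lt_k.
suff /lt_k : root (map_poly ratr ('X^k - p)) w by [].
have -> : map_poly ratr ('X^k - p) = 'X^k - map_poly ratr p :> {poly K}.
  by rewrite -[LHS]/(map_poly (ratrm char0) _) rmorphB; congr (_ - _); apply: map_polyXn.
rewrite rootE !hornerE.
by rewrite ewk subrr.
Qed.

(** * Orders of roots of unity in the span of the M-th roots of unity *)

Lemma roots_of_unity_list M : (0 < M)%N ->
  exists2 r : seq K, size r = M & forall x, (x \in r) = (x ^+ M == 1).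
Proof.
move=> M_gt0; have [r er] := closed_field_poly_normal ('X^M - 1 : {poly K}).
rewrite (monicP (monicXnsubC _ M_gt0)) scale1r in er.
exists r; first by apply: succn_inj; rewrite -(size_prod_XsubC r id) -er size_XnsubC.
by move=> x; rewrite -root_prod_XsubC -er rootE !hornerE subr_eq0.
Qed.

(** The M-th roots of unity are closed under products, and linearity in one factor at a time passes
    this to their span, which is the M-th cyclotomic field. *)
Lemma span_roots_mul M (r : seq K) x y :
  (forall x, (x \in r) = (x ^+ M == 1)) ->
  let A := hull (@is_Qspace K) [set 0] r in A x -> A y -> A (x * y).
Proof.
move=> rE A; have hA : is_Qspace A by apply: Qspace_hull.
have mul_r z : z \in r -> forall x, A x -> A (x * z).
  move=> zr u; apply: (hull_min (G := [set u | A (u * z)])).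
  - split=> [|u1 u2 A1 A2|q u1 A1] /=; first by rewrite mul0r; apply: Qspace0 hA.
      by rewrite mulrBl; apply: (QspaceB hA).
    by rewrite -mulrA; apply: (QspaceZ hA).
  - by move=> ? ->; rewrite /= mul0r; apply: Qspace0 hA.
  - move=> t tr; apply: mem_hull; rewrite rE exprMn.
    by move: zr tr; rewrite !rE => /eqP-> /eqP->; rewrite mulr1.
move=> Ax; move: y; apply: (hull_min (G := [set y | A (x * y)])).
- split=> [|u1 u2 A1 A2|q u1 A1] /=; first by rewrite mulr0; apply: Qspace0 hA.
    by rewrite mulrBr; apply: (QspaceB hA).
  by rewrite mulrCA; apply: (QspaceZ hA).
- by move=> ? ->; rewrite /= mulr0; apply: Qspace0 hA.
- by move=> t tr; apply: mul_r.
Qed.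

(** All powers of [w] stay in the span; [totient n] of them are independent, and M elements span. *)
Lemma span_roots_totient M (r : seq K) n w :
  size r = M -> (forall x, (x \in r) = (x ^+ M == 1)) -> n.-primitive_root w ->
  hull (@is_Qspace K) [set 0] r w -> (totient n <= M)%N.
Proof.
move=> szr rE prim_w Aw; rewrite -szr -[X in (X <= _)%N](size_mkseq (fun i => w ^+ i)).
apply: (steinitz (@Qspace_hull K) (Qspace_exchange char0) (is_Qspace_set0 K)).
  exact: indep_powers.
move=> x /(nthP 0)[i]; rewrite size_mkseq => lti <-; rewrite nth_mkseq //.
elim: i {lti} => [|i IH]; first by apply: mem_hull; rewrite rE !expr1n.
by rewrite exprS; apply: (span_roots_mul rE).
Qed.

(* A prime power [p ^ k] dividing the order exactly satisfies
   [p ^ k <= 2 * totient (p ^ k) <= 2 * M], hence divides [(2 * M)`!]. *)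
Lemma span_roots_order M (r : seq K) n w :
  size r = M -> (forall x, (x \in r) = (x ^+ M == 1)) -> n.-primitive_root w ->
  hull (@is_Qspace K) [set 0] r w -> (n %| (2 * M)`!)%N.
Proof.
move=> szr rE prim_w Aw; have n_gt0 := prim_order_gt0 prim_w.
apply/dvdn_partP => // p /[dup] p_n; rewrite mem_primes => /and3P[p_pr _ p_dvd].
rewrite p_part; set k := logn p n.
have k_gt0 : (0 < k)%N by rewrite logn_gt0.
have dvd_pk : (p ^ k %| n)%N by apply: pfactor_dvdnn.
have prim_v := dvdn_prim_root prim_w dvd_pk.
have Av : hull (@is_Qspace K) [set 0] r (w ^+ (n %/ p ^ k)).
  elim: (n %/ p ^ k)%N => [|i IH]; first by apply: mem_hull; rewrite rE !expr1n.
  by rewrite exprS; apply: (span_roots_mul rE).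
have := span_roots_totient szr rE prim_v Av.
rewrite totient_pfactor // => leM.
apply: dvdn_fact; rewrite expn_gt0 prime_gt0 //=.
rewrite -(prednK k_gt0) expnS; apply: leq_trans (leq_mul (leqnn 2) leM).
rewrite mulnA leq_mul2r; apply/orP; right.
by case: p p_pr {p_n p_dvd k k_gt0 dvd_pk prim_v Av leM} => [|[|p]] //= _; lia.
Qed.

(** Finitely many elements of [X] itself span [X], and they are M-th roots of unity for a common M.
    Every element of [X] then lies in the span of the M-th roots of unity, so its order divides
    (2M)!, which leaves finitely many. *)
Lemma finite_roots_of_unity_span (c : seq K) (X : set K) :
  X `<=` @roots_of_unity K -> X `<=` hull (@is_Qspace K) [set 0] c -> finite_set X.
Proof.
move=> XU Xc.
have [s [_ sX Xs]] := maximal_indep (@Qspace_hull K)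
  (Qspace_exchange char0) (is_Qspace_set0 K) Xc.
have [M M_gt0 sM] : exists2 M, (0 < M)%N & forall x, x \in s -> x ^+ M = 1.
  elim: s sX {Xs} => [|x s IH] sX; first by exists 1%N.
  have [|M M_gt0 sM] := IH; first by move=> y ys; apply: sX; rewrite inE ys orbT.
  have [|n n_gt0 xn] := XU x; first by apply: sX; rewrite inE eqxx.
  exists (n * M)%N => [|y]; first by rewrite muln_gt0 n_gt0.
  rewrite inE => /orP[/eqP->|/sM yM].
    by move/unity_rootP: xn => xn; rewrite exprM xn expr1n.
  by rewrite mulnC exprM yM expr1n.
have [r szr rE] := roots_of_unity_list M_gt0.
have [r' _ r'E] := roots_of_unity_list (fact_gt0 (2 * M)).
apply: (sub_finite_set (B := [set` r'])); last exact: finite_seq.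
move=> x Xx; rewrite /= r'E.
have [m m_gt0 /unity_rootP /(prim_order_exists m_gt0)[n prim_x _]] := XU x Xx.
rewrite -(prim_order_dvd prim_x); apply: (span_roots_order szr rE prim_x).
apply: hull_min (Xs x Xx) => [||y /sM yM]; first exact: Qspace_hull.
  exact: sub_hull.
by apply: mem_hull; rewrite rE yM.
Qed.
End RootsOfUnity.

(** * Vanishing exponential sums *)

Lemma acf_root (K : fieldType) (G : set K) (y : K) d :
  is_acf G -> (0 < d)%N -> G (y ^+ d) -> G y.
Proof.
move=> hG d_gt0 Gy; apply: (acf_closed hG).
exists ('X^d - (y ^+ d)%:P); split; first exact/monic_neq0/monicXnsubC.
  move=> i; rewrite coefB coefXn coefC; apply: (subfieldB hG); first exact: (subfield_nat hG).
  by case: eqP => _; [|exact: (subfield0 hG)].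
by rewrite rootE !hornerE subrr.
Qed.

(** [q] clears the denominators and the shift [M] makes all exponents natural numbers, so that a
    Laurent polynomial can be handled as a polynomial. *)
Lemma common_denominator (I : finType) (r : I -> rat) :
  exists (q M : nat) (n : I -> nat), (0 < q)%N /\
    forall i, (n i)%:R = q%:R * r i + M%:R.
Proof.
pose d i := `|denq (r i)|%N.
have d_gt0 i : (0 < d i)%N by rewrite absz_gt0 denq_neq0.
pose q := (\prod_i d i)%N.
pose z i : int := numq (r i) * (\prod_(j | j != i) d j)%N%:Z.
have zE i : (z i)%:~R = q%:R * r i.
  rewrite /q (bigD1 i) //= natrM rmorphM /= -pmulrn mulrAC; congr (_ * _).
  rewrite -[(d i)%:R]/((d i)%:~R) /d absz_denq.
  by rewrite numqE mulrC.
pose M := (\sum_i `|z i|%N)%N.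
exists q, M, (fun i => `|(z i + M%:Z)%R|%N); split; first by rewrite prodn_gt0.
move=> i; rewrite -zE.
have zM : (0 <= z i + M%:Z) by rewrite /M (bigD1 i) //=; lia.
by rewrite -[LHS]/((Posz _)%:~R) gez0_abs // rmorphD.
Qed.

Section Exponential.
Variables (K : closedFieldType) (e : K -> K) (hK : LEC_field e).
Let char0 := LEC_char0 hK.

Lemma exp0 : e 0 = 1.
Proof.
by apply: (mulfI (LEC_exp_neq0 hK 0)); rewrite -(LEC_expD hK) addr0 mulr1.
Qed.

Lemma expB x y : e (x - y) = e x / e y.
Proof.
by apply: (mulIf (LEC_exp_neq0 hK y)); rewrite -(LEC_expD hK) subrK divfK // (LEC_exp_neq0 hK).
Qed.

Lemma exp_natM n x : e (n%:R * x) = e x ^+ n.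
Proof.
elim: n => [|n IH]; first by rewrite mul0r exp0.
by rewrite mulrS mulrDl mul1r (LEC_expD hK) IH exprS.
Qed.

Lemma exp_intM (G : set K) (m : int) x : is_subfield G -> G (e x) -> G (e (m%:~R * x)).
Proof.
move=> hG Gx; case: m => n; first by rewrite -pmulrn exp_natM; apply: subfieldX.
rewrite NegzE mulrNz mulNr -sub0r expB exp0; apply: (subfield_div hG); first exact: subfield1 hG.
by rewrite -pmulrn exp_natM; apply: subfieldX.
Qed.

(** With r = a / b, the b-th power of e(r x) is the a-th power of e(x), and [G] is closed under
    taking roots. *)
Lemma exp_Qspace (G : set K) : is_acf G -> is_Qspace [set x | G (e x)].
Proof.
move=> hG; split=> [|x y Gx Gy|r x Gx] /=; first by rewrite exp0; apply: subfield1 hG.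
  by rewrite expB; apply: (subfield_div hG).
apply: (@acf_root _ _ _ `|denq r|%N) => //; first by rewrite absz_gt0 denq_neq0.
rewrite -exp_natM mulrA.
suff -> : `|denq r|%:R * ratr r = (numq r)%:~R :> K by apply: exp_intM => //; apply: acf_subfield.
rewrite -[`|_|%:R]/((Posz `|denq r|)%:~R) absz_denq /ratr mulrC divfK //.
by rewrite char0_int_eq0 // denq_neq0.
Qed.

(* Writing the exponents as [tau j = r j * h + v j] with [e (v j)] in [G], the
   vanishing sum is a Laurent polynomial equation for [e (h / q)] over [G]. *)
Lemma exp_algebraic_of_relation (I : finType) (J : {set I}) (lambda tau : I -> K)
    (G : set K) (h : K) (r : I -> rat) (j0 : I) :
  is_acf G -> (forall j, j \in J -> G (lambda j)) ->
  (forall j, j \in J -> G (e (tau j - ratr (r j) * h))) ->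
  \sum_(j in J) lambda j * e (tau j) = 0 ->
  \sum_(j in J | r j == r j0) lambda j * e (tau j) != 0 -> G (e h).
Proof.
move=> hG Gl Gv sum0 sub_neq0.
have [q [M [n [q_gt0 nE]]]] := common_denominator r.
have q0 : q%:R != 0 :> rat by rewrite pnatr_eq0 -lt0n.
have qK0 : q%:R != 0 :> K by rewrite -(ratr_nat K) (fmorph_eq0 (ratrm char0)).
have nKE j : (n j)%:R = q%:R * ratr (r j) + M%:R :> K.
  by rewrite -!(ratr_nat K) nE (ratrD char0) (ratrM char0).
pose k := h / q%:R.
have hk : h = q%:R * k by rewrite mulrC divfK.
pose v j := tau j - ratr (r j) * h.
pose P := \sum_(j in J) (lambda j * e (v j)) *: 'X^(n j).
suff Gk : G (e k) by rewrite hk exp_natM; apply: subfieldX => //; apply: acf_subfield.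
apply: (acf_closed hG); exists P; split.
(* Multiplied by [e (ratr (r j0) * h)], the coefficient of degree [n j0] is the partial sum over the
   indices with [r j = r j0], nonzero by hypothesis. *)
- apply: contra_neq sub_neq0 => P0.
  have := congr1 (fun p : {poly K} => p`_(n j0) * e (ratr (r j0) * h)) P0.
  rewrite coef0 mul0r coef_sum mulr_suml => sumE.
  rewrite -[RHS]sumE big_mkcondr; apply: eq_bigr => j _; rewrite coefZ coefXn.
  have -> : (n j0 == n j) = (r j == r j0).
    by rewrite eq_sym -(eqr_nat rat) !nE (inj_eq (addIr _)) (inj_eq (mulfI q0)).
  case: eqP => [<-|_]; last by rewrite mulr0 mul0r.
  by rewrite mulr1 -mulrA -(LEC_expD hK) subrK.
- move=> i; rewrite coef_sum; apply: subfield_sum => [|j jJ]; first exact: acf_subfield.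
  rewrite coefZ coefXn; apply: subfieldM; first exact: acf_subfield.
    by apply: subfieldM; [apply: acf_subfield|apply: Gl|apply: Gv].
  by apply: subfield_nat; apply: acf_subfield.
- apply/rootP; transitivity (e (M%:R * k) * \sum_(j in J) lambda j * e (tau j)).
    rewrite horner_sum mulr_sumr; apply: eq_bigr => j _.
    rewrite hornerZ hornerXn -exp_natM -mulrA -(LEC_expD hK).
    by rewrite [RHS]mulrCA -(LEC_expD hK) nKE /v hk; congr (_ * e _); ring.
  by rewrite sum0 mulr0.
Qed.

(** * Schanuel's conjecture and the defect *)

Hypothesis SC : Schanuel e.

(* [k] is the defect: how much the transcendence degree of the [e x], [x \in c],
   over [L = hull set0 gens] falls short of [size c]. *)
Definition defect_witness (gens : seq K) k (c t : seq K) :=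
  let L := hull (@is_acf K) set0 gens in
  [/\ indep (@is_Qspace K) [set 0] c, forall x, x \in c -> L x,
      forall x, x \in c -> hull (@is_acf K) L t (e x) & (size t + k <= size c)%N].

(** Up to algebraic closure, [gens ++ t] generates all of [c] and its exponentials, whose
    transcendence degree is at least [size c] by Schanuel's conjecture. *)
Lemma defect_le gens k c t : defect_witness gens k c t -> (k <= size gens)%N.
Proof.
move=> [ind_c cL ct le_ck].
have : trdeg_ge [tuple of in_tuple c ++ map_tuple e (in_tuple c)] (size c).
  by apply: SC; exists (in_tuple c); split=> //; apply: indep_lin_independent.
move=> /(trdeg_ge_size char0 (t := gens ++ t)) le_c.
suff : (size c <= size (gens ++ t))%N by rewrite size_cat; lia.
apply: le_c => i; rewrite -(hull_cat (@acf_hull K)).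
have := mem_tnth i [tuple of in_tuple c ++ map_tuple e (in_tuple c)].
rewrite mem_cat => /orP[/cL|/mapP[x xc ->]]; first exact: sub_hull.
exact: ct.
Qed.

(** [c] is extended by a maximal list of exponents independent modulo its span. The exponentials of
    all of them but the last, [h], are added to [t]; the relation makes [e h] algebraic over what is
    then generated, so [c] gains one element more than [t]. *)
Lemma defectS (gens : seq K) k c t (I : finType) (J : {set I}) (lambda tau : I -> K)
    (i0 : I) (L := hull (@is_acf K) set0 gens) :
  defect_witness gens k c t ->
  (exists2 j, j \in J & ~ hull (@is_Qspace K) [set 0] c (tau j)) ->
  i0 \in J -> tau i0 = 0 ->
  (forall j, j \in J -> L (lambda j)) -> (forall j, j \in J -> L (tau j)) ->
  \sum_(j in J) lambda j * e (tau j) = 0 ->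
  (forall J' : {set I}, J' \proper J -> J' != finset.set0 ->
     \sum_(j in J') lambda j * e (tau j) != 0) ->
  exists c' t', defect_witness gens k.+1 c' t'.
Proof.
move=> [ind_c cL ct le_ck] [j jJ nj] i0J tau0 lL tL sum0 min_sum.
set V := hull (@is_Qspace K) [set 0] c in nj.
have hV : is_Qspace V := Qspace_hull _ _.
pose X : set K := [set x | exists2 i, i \in J & x = tau i].
have [|s [ind_s sX Xs]] := maximal_indep (@Qspace_hull K) (Qspace_exchange char0)
    (c := [seq tau i | i in J]) (X := X) hV.
  by move=> x [i iJ ->]; apply: mem_hull; apply: fintype.image_f.
case/lastP: s => [|s h] in ind_s sX Xs.
  by case: nj; have := Xs (tau j); rewrite (hull_nil hV); apply; exists j.
have [i1 i1J hE] : X h by apply: sX; rewrite mem_rcons inE eqxx.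
have ind_cs : indep (@is_Qspace K) [set 0] (rcons (c ++ s) h).
  by rewrite rcons_cat; apply: (indep_cat (@Qspace_hull K)) => //; apply: is_Qspace_set0.
have [_ nh] := (indep_rcons (@Qspace_hull K) (c ++ s) h (is_Qspace_set0 K)).1 ind_cs.
set W := hull (@is_Qspace K) [set 0] (c ++ s) in nh.
have hW : is_Qspace W := Qspace_hull _ _.
have /choice[r rE] i : exists r : rat, i \in J -> W (tau i - ratr r * h).
  have [iJ|_] := boolP (i \in J); last by exists 0.
  have [|r Wr] := @Qspace_hull1 _ char0 W h (tau i) hW; last by exists r.
  rewrite hull_cat; last exact: Qspace_hull.
  have := Xs (tau i); rewrite hull_cat; last exact: Qspace_hull.
  by rewrite -catA cats1; apply; exists i.
(* The coordinates along [h] are 0 at [i0] and 1 at [i1], so the indices with coordinate 1 form a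
   nonempty proper subset of [J], whose sum does not vanish by minimality. *)
have r0 : r i0 = 0.
  apply: contra_notP nh => /eqP r0.
  have := rE i0 i0J; rewrite tau0 sub0r => /(QspaceN hW); rewrite opprK.
  move=> /(QspaceZ hW (r i0)^-1); rewrite mulrA -(ratrM char0) mulVf //.
  by rewrite (rmorph1 (ratrm char0)) mul1r.
have r1 : r i1 = 1.
  apply: contra_notP nh => /eqP r1.
  have r1' : 1 - r i1 != 0 by rewrite subr_eq0 eq_sym.
  have := rE i1 i1J; rewrite -hE -{1}[h]mul1r -mulrBl.
  rewrite -[X in X - _](rmorph1 (ratrm char0)) -(rmorphB (ratrm char0)) /=.
  move=> /(QspaceZ hW (1 - r i1)^-1); rewrite mulrA -(ratrM char0) mulVf //.
  by rewrite (rmorph1 (ratrm char0)) mul1r.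
set t' := t ++ map e s.
pose G := hull (@is_acf K) L t'.
have hG : is_acf G := acf_hull _ _.
have tG : hull (@is_acf K) L t `<=` G.
  apply: hull_min => // [|x xt]; first exact: sub_hull.
  by apply: mem_hull; rewrite mem_cat xt.
have LG : L `<=` G by exact: sub_hull.
have csG x : x \in c ++ s -> G (e x).
  rewrite mem_cat => /orP[/ct/tG //|xs].
  by apply: mem_hull; rewrite mem_cat map_f ?orbT.
have WG x : W x -> G (e x).
  move: x; apply: hull_min; [exact: exp_Qspace| |exact: csG].
  by move=> x ->; apply: (Qspace0 (exp_Qspace hG)).
have hGe : G (e h).
  apply: (@exp_algebraic_of_relation _ J lambda tau G h r i1) => //.
  - by move=> i /lL/LG.
  - by move=> i /rE/WG.
  - have := min_sum [set i in J | r i == r i1]%SET.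
    rewrite (eq_bigl (fun i => (i \in J) && (r i == r i1))) => [|i]; last by rewrite inE.
    apply; last by apply/set0Pn; exists i1; rewrite inE i1J eqxx.
    apply/fintype.properP; split; first by apply/fintype.subsetP => i; rewrite inE => /andP[].
    by exists i0 => //; rewrite inE i0J r0 r1 eq_sym oner_eq0.
exists (rcons (c ++ s) h), t'; split=> //.
- move=> x; rewrite mem_rcons inE mem_cat => /or3P[/eqP->|/cL //|xs].
    by rewrite hE; apply: tL.
  have [i iJ ->] : X x by apply: sX; rewrite mem_rcons inE xs orbT.
  exact: tL.
- by move=> x; rewrite mem_rcons inE => /orP[/eqP->|/csG].
- by rewrite /t' size_rcons !size_cat size_map; lia.
Qed.

(** Suppose [mu j1] differs from [mu j0]. For a witness [c] of maximal defect, [defectS] forces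
    [(mu j1 - mu j0) * x] into the span of [c] for every x in [X], so [X] lies in a
    finite-dimensional space and is finite. *)
Lemma minimal_relation N (lambda mu : 'I_N -> K) (J : {set 'I_N}) (X : set K) j0 :
  X `<=` @roots_of_unity K -> infinite_set X -> j0 \in J ->
  (forall x, X x -> \sum_(j in J) lambda j * e (mu j * x) = 0) ->
  (forall x, X x -> forall J' : {set 'I_N}, J' \proper J -> J' != finset.set0 ->
     \sum_(j in J') lambda j * e (mu j * x) != 0) ->
  forall j, j \in J -> mu j = mu j0.
Proof.
move=> XU Xinf j0J sum0 min_sum j1 j1J; apply: contra_notP Xinf => /eqP mu10.
pose gens := codom lambda ++ codom mu; pose L := hull (@is_acf K) set0 gens.
have hL : is_acf L := acf_hull _ _.
have lL j : L (lambda j) by apply: mem_hull; rewrite mem_cat codom_f.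
have mL j : L (mu j) by apply: mem_hull; rewrite mem_cat codom_f orbT.
have XL x : X x -> L x.
  move=> /XU[n n_gt0 /unity_rootP xn]; apply: (acf_root hL n_gt0).
  by rewrite xn; apply: subfield1 hL.
(* A maximal defect exists: 0 is attained by empty lists, and [defect_le] bounds every defect by
   [size gens]. *)
have [k [[c [t wit]] nS]] : exists k, (exists c t, defect_witness gens k c t) /\
    ~ (exists c t, defect_witness gens k.+1 c t).
  apply: contrapT => /forallNP nmax.
  suff /(_ (size gens).+1)[c [t /defect_le]] k : exists c t, defect_witness gens k c t.
    by rewrite ltnn.
  elim: k => [|k IH]; first by exists [::], [::].
  by apply: contrapT => nk; apply: (nmax k).
(* Dividing by [e (mu j0 * x)] makes the exponent at [j0] zero, as [defectS] requires, and preserves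
   vanishing and minimality. *)
pose nu j := mu j - mu j0.
have tauE x j : e (nu j * x) = e (mu j * x) / e (mu j0 * x).
  by rewrite mulrBl expB.
have sumE x (J' : {set 'I_N}) : \sum_(j in J') lambda j * e (nu j * x) =
    (\sum_(j in J') lambda j * e (mu j * x)) / e (mu j0 * x).
  by rewrite mulr_suml; apply: eq_bigr => j _; rewrite tauE mulrA.
have Xc x : X x -> hull (@is_Qspace K) [set 0] c (nu j1 * x).
  move=> Xx; apply: contrapT => nx; apply: nS.
  apply: (@defectS gens k c t _ J lambda (fun j => nu j * x) j0) => //.
  - by exists j1.
  - by rewrite /nu subrr mul0r.
  - by move=> j _; apply: lL.
  - move=> j jJ /=; apply: (subfieldM hL); last exact: XL.
    by apply: (subfieldB hL).
  - by rewrite sumE sum0 ?mul0r.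
  - move=> J' pJ' J'0; rewrite sumE mulf_neq0 ?invr_eq0 ?(LEC_exp_neq0 hK) //.
    exact: min_sum.
have nu0 : nu j1 != 0 by rewrite subr_eq0.
apply: (finite_roots_of_unity_span char0 (c := [seq (nu j1)^-1 * z | z <- c])) => //.
move=> x /Xc; rewrite -{2}[x](mulKf nu0); set y := nu j1 * x.
set V := hull _ _ (map _ _); have hV : is_Qspace V := Qspace_hull _ _.
move: y; apply: hull_min.
- split=> [|u v Vu Vv|r u Vu] /=; first by rewrite mulr0; apply: Qspace0 hV.
    by rewrite mulrBr; apply: (QspaceB hV).
  by rewrite mulrCA; apply: (QspaceZ hV).
- by move=> y ->; rewrite /= mulr0; apply: Qspace0 hV.
- by move=> z zc; apply: mem_hull; apply: map_f.
Qed.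

(** Induction on the size of [J]: some subset [A] carries a minimal vanishing subsum for infinitely
    many x, its exponents coincide, and it is removed from [J] while [X] is kept. *)
Lemma exp_sum_vanish N (lambda mu : 'I_N -> K) (J : {set 'I_N}) (X : set K) :
  X `<=` @roots_of_unity K -> infinite_set X ->
  (forall x, X x -> \sum_(j in J) lambda j * e (mu j * x) = 0) ->
  forall z, \sum_(j in J) lambda j * e (mu j * z) = 0.
Proof.
elim/ltn_ind: #|J| {-2}J (erefl #|J|) X => n IH {}J cardJ X XU Xinf sum0 z.
have [->|J0] := eqVneq J finset.set0; first by rewrite big_set0.
pose P x (A : {set 'I_N}) := (A != finset.set0) &&
  (\sum_(j in A) lambda j * e (mu j * x) == 0).
(* Pigeonhole: finitely many sets, indexed by the nonempty subsets of [J], cover [X]. *)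
have [A /andP[AJ A0] Ainf] : exists2 A : {set 'I_N}, 
    (A \subset J) && (A != finset.set0) & infinite_set (X `&` [set x | minset (P x) A]).
  apply: contrapT => nA; apply: Xinf.
  pose D : set {set 'I_N} := fun A => (A \subset J) && (A != finset.set0).
  have cover : X `<=` \bigcup_(A in D) (X `&` [set x | minset (P x) A]).
    move=> x Xx; have [|A mA AJ] := @minset_exists _ (P x) J.
      by rewrite /P J0 sum0 ?eqxx.
    by exists A => //=; rewrite /D AJ; have /andP[->] := minsetp mA.
  apply: (sub_finite_set cover); apply: bigcup_finite => [|A hA].
    exact: finite_finset.
  by apply: contrapT => infA; apply: nA; exists A.
have [j0 j0A] := set0Pn _ A0.
have AX x : (X `&` [set x | minset (P x) A]) x ->
    \sum_(j in A) lambda j * e (mu j * x) = 0.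
  by move=> [_ /minsetp/andP[_ /eqP]].
have muA := minimal_relation (subset_trans (@subIsetl _ _ _) XU) Ainf j0A AX.
have {}muA j : j \in A -> mu j = mu j0.
  apply: muA => x [_ mA] J' pJ' J'0; apply: contraT; rewrite negbK => s0.
  have /minsetP[_ /(_ J')] := mA.
  rewrite /P J'0 s0 => /(_ isT (proper_sub pJ')) eJ'.
  by rewrite eJ' fintype.properxx in pJ'.
have sumA y : \sum_(j in A) lambda j * e (mu j * y) = (\sum_(j in A) lambda j) * e (mu j0 * y).
  by rewrite mulr_suml; apply: eq_bigr => j /muA->.
(* One point suffices to see that the [lambda j] with j in [A] sum to 0, since the common
   exponential never vanishes. *)
have [x0 x0A] := infinite_setN0 Ainf.
have sumA0 y : \sum_(j in A) lambda j * e (mu j * y) = 0.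
  move/eqP: (AX x0 x0A); rewrite !sumA mulf_eq0 (negPf (LEC_exp_neq0 hK _)) orbF.
  by move=> /eqP->; rewrite mul0r.
have sumD y : \sum_(j in J) lambda j * e (mu j * y) =
    \sum_(j in J :\: A) lambda j * e (mu j * y).
  by rewrite (big_setID A) /= (finset.setIidPr AJ) sumA0 add0r.
rewrite sumD; apply: (IH #|J :\: A| _ _ (erefl _) X) => // [|x Xx]; last by rewrite -sumD sum0.
rewrite -cardJ; apply: proper_card; apply/fintype.properP; split; first exact: finset.subsetDl.
by exists j0; [apply: (fintype.subsetP AJ)|rewrite inE j0A].
Qed.
End Exponential.

Theorem theorem5p1 (K : closedFieldType) (e : K -> K) (hK : LECS_field e)
  (f : K -> K) (hf : exp_poly e f)
  (X : set K) (hXU : X `<=` @roots_of_unity K) (hXinf : infinite_set X)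
  (hX0 : forall x, X x -> f x = 0) :
  forall z, f z = 0.
Proof.
case: hK hf => hL SC [N [lambda [mu fE]]] z.
have sumT x : f x = \sum_(j in finset.setT) lambda j * e (mu j * x).
  by rewrite fE; apply: eq_bigl => j; rewrite inE.
rewrite sumT; apply: (exp_sum_vanish hL SC hXU hXinf) => x Xx.
by rewrite -sumT hX0.
Qed.
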